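(* Fix $p_1,p_2,q_1,q_2,c_1,c_2\in\mathbb{Z}$ with $p_1q_2-p_2q_1=1$. Let $F:\mathbb{Z}^2\to\mathbb{Z}$ be one of the following functions: (a) $\Psi_{\mathrm{edge}}(x,y)=\min(0,p_1x+q_1y)$; (b) $\Psi_{\mathrm{vertex}}(x,y)=\min(0,p_1x+q_1y,p_2x+q_2y+c_1)$; (c) $\Psi_{\mathrm{node}}(x,y)=\min(0,p_1x+q_1y,p_2x+q_2y+c_1,(p_1+p_2)x+(q_1+q_2)y+c_2)$. Then the sequence of $n$-smoothings $S_n(F)$ stabilizes eventually: there exists $N>0$ such that $S_n(F)=S_N(F)$ for all $n>N$.
   Context: The discrete Laplacian is $\Delta F(x,y)=-4F(x,y)+F(x+1,y)+F(x-1,y)+F(x,y+1)+F(x,y-1)$. The function $F$ is superharmonic if $\Delta F\le0$ everywhere. The deviation set is $D(F)=\{v:\Delta F(v)\ne0\}$. For $A\subset\mathbb{Z}^2$, $B_C(A)$ is the set of points at distance at most $C$ from $A$. For a superharmonic $F:\mathbb{Z}^2\to\mathbb{Z}$ and $n\ge0$, let $\Theta_n(F)$ be the set of all $G:\mathbb{Z}^2\to\mathbb{Z}$ such that: - $\Delta G\le0$; - $F-n\le G\le F$; - $\{F\ne G\}\subset B_C(D(F))$ for some $C>0$. The $n$-smoothing of $F$ is $S_n(F)(v)=\min\{G(v):G\in\Theta_n(F)\}$. The functions in (a)–(c) are superharmonic, being minima of affine functions. *)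

(* Defs.v *)
From Stdlib Require Import ZArith Reals Lia ClassicalEpsilon.

Open Scope Z_scope.

Definition laplacian (F : Z * Z -> Z) (v : Z * Z) : Z :=
  let (x, y) := v in
  - 4 * F (x, y) + F (x + 1, y) + F (x - 1, y) + F (x, y + 1) + F (x, y - 1).

Definition superharmonic (F : Z * Z -> Z) : Prop :=
  forall v, laplacian F v <= 0.

Definition deviation_set (F : Z * Z -> Z) (v : Z * Z) : Prop :=
  laplacian F v <> 0.

Definition dist_lattice (v w : Z * Z) : R :=
  dist_euc (IZR (fst v)) (IZR (snd v)) (IZR (fst w)) (IZR (snd w)).

(* The distance from a point to a nonempty subset of the lattice is attained,
   so no infimum is needed; the neighbourhood of the empty set is empty. *)
Definition neighborhood (C : R) (A : Z * Z -> Prop) (v : Z * Z) : Prop :=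
  exists w, A w /\ (dist_lattice v w <= C)%R.

Definition Theta (n : nat) (F G : Z * Z -> Z) : Prop :=
  superharmonic G /\
  (forall v, F v - Z.of_nat n <= G v <= F v) /\
  (exists C : R, (C > 0)%R /\
     forall v, F v <> G v -> neighborhood C (deviation_set F) v).

Definition is_minimum (A : Z -> Prop) (m : Z) : Prop :=
  A m /\ forall k, A k -> m <= k.

Definition Theta_values (n : nat) (F : Z * Z -> Z) (v : Z * Z) (k : Z) : Prop :=
  exists G, Theta n F G /\ k = G v.

(* The value is arbitrary when the minimum does not exist; by [smoothing_spec]
   this never happens for superharmonic [F]. *)
Definition smoothing (n : nat) (F : Z * Z -> Z) (v : Z * Z) : Z :=
  epsilon (inhabits 0) (is_minimum (Theta_values n F v)).

Definition Psi_edge (p1 q1 : Z) (v : Z * Z) : Z :=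
  let (x, y) := v in Z.min 0 (p1 * x + q1 * y).

Definition Psi_vertex (p1 q1 p2 q2 c1 : Z) (v : Z * Z) : Z :=
  let (x, y) := v in
  Z.min (Z.min 0 (p1 * x + q1 * y)) (p2 * x + q2 * y + c1).

Definition Psi_node (p1 q1 p2 q2 c1 c2 : Z) (v : Z * Z) : Z :=
  let (x, y) := v in
  Z.min (Z.min (Z.min 0 (p1 * x + q1 * y)) (p2 * x + q2 * y + c1))
        ((p1 + p2) * x + (q1 + q2) * y + c2).

Lemma bounded_below_minimum (A : Z -> Prop) (b a : Z) :
  (forall k, A k -> b <= k) -> A a -> exists m, is_minimum A m.
Proof.
  intros Hb. remember (Z.to_nat (a - b)) as d eqn:Hd.
  revert a Hd. induction d as [d IH] using lt_wf_ind. intros a Hd Ha.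
  destruct (classic (exists k, A k /\ k < a)) as [[k [Hk Hlt]] | Hno].
  - apply (IH (Z.to_nat (k - b))) with (a := k); auto.
    pose proof (Hb k Hk). lia.
  - exists a. split; auto. intros k Hk.
    destruct (Z_lt_le_dec k a); auto. exfalso; eauto.
Qed.

Lemma Theta_self (n : nat) (F : Z * Z -> Z) : superharmonic F -> Theta n F F.
Proof.
  intros HF. split; [exact HF | split].
  - intros v; lia.
  - exists 1%R. split; [apply Rlt_0_1 | intros v Hv; contradiction].
Qed.

Lemma smoothing_spec (n : nat) (F : Z * Z -> Z) (v : Z * Z) :
  superharmonic F -> is_minimum (Theta_values n F v) (smoothing n F v).
Proof.
  intros HF. unfold smoothing. apply epsilon_spec.
  apply (bounded_below_minimum _ (F v - Z.of_nat n) (F v)).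
  - intros k [G [[_ [HG _]] ->]]. apply HG.
  - exists F. split; [apply Theta_self, HF | reflexivity].
Qed.

Lemma superharmonic_affine (p q c : Z) :
  superharmonic (fun v => p * fst v + q * snd v + c).
Proof. intros [x y]. unfold laplacian; simpl fst; simpl snd. lia. Qed.

Lemma superharmonic_min (F G : Z * Z -> Z) :
  superharmonic F -> superharmonic G -> superharmonic (fun v => Z.min (F v) (G v)).
Proof.
  intros HF HG [x y]. specialize (HF (x, y)). specialize (HG (x, y)).
  unfold laplacian in *. lia.
Qed.

Lemma superharmonic_ext (F G : Z * Z -> Z) :
  (forall v, F v = G v) -> superharmonic F -> superharmonic G.
Proof.
  intros E HF [x y]. specialize (HF (x, y)). unfold laplacian in *.
  now rewrite <- !E.
Qed.

Lemma superharmonic_Psi_edge (p1 q1 : Z) : superharmonic (Psi_edge p1 q1).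
Proof.
  eapply superharmonic_ext;
    [| apply (superharmonic_min _ _ (superharmonic_affine 0 0 0)
                                    (superharmonic_affine p1 q1 0))].
  intros [x y]. simpl fst; simpl snd. unfold Psi_edge. f_equal; ring.
Qed.

Lemma superharmonic_Psi_vertex (p1 q1 p2 q2 c1 : Z) :
  superharmonic (Psi_vertex p1 q1 p2 q2 c1).
Proof.
  eapply superharmonic_ext;
    [| apply (superharmonic_min _ _ (superharmonic_Psi_edge p1 q1)
                                    (superharmonic_affine p2 q2 c1))].
  now intros [x y].
Qed.

Lemma superharmonic_Psi_node (p1 q1 p2 q2 c1 c2 : Z) :
  superharmonic (Psi_node p1 q1 p2 q2 c1 c2).
Proof.
  eapply superharmonic_ext;
    [| apply (superharmonic_min _ _ (superharmonic_Psi_vertex p1 q1 p2 q2 c1)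
                                    (superharmonic_affine (p1 + p2) (q1 + q2) c2))].
  now intros [x y].
Qed.

(* Main.v *)
(** It suffices to bound [F - G] uniformly over all [n] and all [G] in
    [Theta n F].  In the unimodular coordinates [l1 = p1 x + q1 y],
    [l2 = p2 x + q2 y] the slopes of [F] are vertices of the unit square.
    Replacing [G] by its infimal convolution with the support function of the
    square, one may assume that the increments of [G] along both coordinates
    are 0 or 1.  An integer harmonic function on a ball with such increments is
    affine with slope a vertex of the square, because its increments are
    harmonic and attain an extremum.  The minimum principle then spreads this
    affine behaviour along the diagonal of a quadrant up to infinity, where [G]
    coincides with [F]; hence [F <= G] at the centre of the ball.  Finally, the
    mass of the Laplacian in a square is at most linear in its side, so a
    harmonic ball of given radius exists within bounded distance of every point,
    and [F - G] is Lipschitz. *)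

Require Import Defs.
From Stdlib Require Import ZArith Reals Lra Lia Classical ClassicalEpsilon FunctionalExtensionality.

Open Scope Z_scope.

(** * Finite sums over integer segments *)

Fixpoint sumZ (n : nat) (f : Z -> Z) : Z :=
  match n with
  | O => 0
  | S k => sumZ k f + f (Z.of_nat k)
  end.

Lemma sumZ_le (n : nat) (f g : Z -> Z) :
  (forall i, 0 <= i < Z.of_nat n -> f i <= g i) -> sumZ n f <= sumZ n g.
Proof.
  induction n as [|n IH]; intros H; cbn [sumZ]; [lia|].
  assert (sumZ n f <= sumZ n g) by (apply IH; intros; apply H; lia).
  assert (f (Z.of_nat n) <= g (Z.of_nat n)) by (apply H; lia). lia.
Qed.

Lemma sumZ_ext (n : nat) (f g : Z -> Z) :
  (forall i, 0 <= i < Z.of_nat n -> f i = g i) -> sumZ n f = sumZ n g.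
Proof. intros H. apply Z.le_antisymm; apply sumZ_le; intros i Hi; rewrite H; lia. Qed.

Lemma sumZ_const (n : nat) (c : Z) : sumZ n (fun _ => c) = Z.of_nat n * c.
Proof. induction n as [|n IH]; cbn [sumZ]; lia. Qed.

Lemma sumZ_add (n : nat) (f g : Z -> Z) :
  sumZ n (fun i => f i + g i) = sumZ n f + sumZ n g.
Proof. induction n as [|n IH]; cbn [sumZ]; lia. Qed.

Lemma sumZ_swap (m n : nat) (f : Z -> Z -> Z) :
  sumZ m (fun i => sumZ n (f i)) = sumZ n (fun j => sumZ m (fun i => f i j)).
Proof.
  induction m as [|m IH]; cbn [sumZ].
  - rewrite sumZ_const; lia.
  - now rewrite IH, sumZ_add.
Qed.

Lemma sumZ_app (m n : nat) (f : Z -> Z) :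
  sumZ (m + n) f = sumZ m f + sumZ n (fun i => f (Z.of_nat m + i)).
Proof.
  induction n as [|n IH]; cbn [sumZ].
  - rewrite Nat.add_0_r; lia.
  - rewrite Nat.add_succ_r; cbn [sumZ]. rewrite IH, Nat2Z.inj_add; lia.
Qed.

Lemma sumZ_blocks (k r : nat) (f : Z -> Z) :
  sumZ (k * r) f = sumZ k (fun b => sumZ r (fun i => f (b * Z.of_nat r + i))).
Proof.
  induction k as [|k IH]; cbn [sumZ]; [reflexivity|].
  replace (S k * r)%nat with (k * r + r)%nat by lia.
  rewrite sumZ_app, IH, Nat2Z.inj_mul. reflexivity.
Qed.

Lemma sumZ_le_term (n : nat) (f : Z -> Z) (j : Z) :
  (forall i, 0 <= i < Z.of_nat n -> f i <= 0) -> 0 <= j < Z.of_nat n ->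
  sumZ n f <= f j.
Proof.
  induction n as [|n IH]; intros H Hj; cbn [sumZ]; [lia|].
  assert (f (Z.of_nat n) <= 0) by (apply H; lia).
  destruct (Z.eq_dec j (Z.of_nat n)) as [-> | Hne].
  - assert (sumZ n f <= sumZ n (fun _ => 0)) as Hs
      by (apply sumZ_le; intros; apply H; lia).
    rewrite sumZ_const in Hs; lia.
  - assert (sumZ n f <= f j) by (apply IH; [intros; apply H|]; lia). lia.
Qed.

(** The sum telescopes to its boundary terms: Green's formula in dimension one. *)
Lemma sumZ_second_difference (n : nat) (f : Z -> Z) (x : Z) :
  sumZ n (fun i => f (x + i + 1) + f (x + i - 1) - 2 * f (x + i)) =
  f (x + Z.of_nat n) - f (x + Z.of_nat n - 1) - (f x - f (x - 1)).
Proof.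
  induction n as [|n IH]; cbn [sumZ].
  - change (Z.of_nat 0) with 0. rewrite Z.add_0_r. lia.
  - rewrite IH.
    replace (x + Z.of_nat (S n)) with (x + Z.of_nat n + 1) by lia.
    replace (x + Z.of_nat n + 1 - 1) with (x + Z.of_nat n) by lia. lia.
Qed.

(** * Lipschitz superharmonic functions and harmonic blocks *)

Definition lipschitz (L : Z) (F : Z * Z -> Z) : Prop :=
  forall x y, Z.abs (F (x + 1, y) - F (x, y)) <= L /\
              Z.abs (F (x, y + 1) - F (x, y)) <= L.

(* By Green's formula the sum is the flux of the gradient through the boundary
   of the square. *)
Lemma laplacian_sum_ge (G : Z * Z -> Z) (L : Z) (n : nat) (x y : Z) :
  lipschitz L G ->
  - (4 * L * Z.of_nat n) <=
  sumZ n (fun i => sumZ n (fun j => laplacian G (x + i, y + j))).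
Proof.
  intros HL.
  (* Horizontal and vertical second differences telescope separately along their own lines; each of
     the [2n] lines contributes at least [-2L]. *)
  rewrite (sumZ_ext n _ (fun i =>
    sumZ n (fun j => G (x + i + 1, y + j) + G (x + i - 1, y + j)
                     - 2 * G (x + i, y + j)) +
    sumZ n (fun j => G (x + i, y + j + 1) + G (x + i, y + j - 1)
                     - 2 * G (x + i, y + j)))).
  2:{ intros i _. rewrite <- sumZ_add. apply sumZ_ext. intros j _.
      unfold laplacian. lia. }
  rewrite sumZ_add, sumZ_swap.
  assert (forall f, (forall i, - (2 * L) <= f i) ->
            - (2 * L * Z.of_nat n) <= sumZ n f) as Hlow.
  { intros f Hf. assert (sumZ n (fun _ => - (2 * L)) <= sumZ n f) as Hs
      by (apply sumZ_le; auto). rewrite sumZ_const in Hs. lia. }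
  match goal with |- _ <= sumZ n ?f + sumZ n ?g =>
    assert (- (2 * L * Z.of_nat n) <= sumZ n f);
    [| assert (- (2 * L * Z.of_nat n) <= sumZ n g) ] end; [| |lia];
    apply Hlow; intros i.
  - rewrite (sumZ_second_difference n (fun a => G (a, y + i))).
    destruct (HL (x + Z.of_nat n - 1) (y + i)) as [H1 _].
    destruct (HL (x - 1) (y + i)) as [H2 _].
    rewrite Z.sub_add in H1, H2. lia.
  - rewrite (sumZ_second_difference n (fun a => G (x + i, a))).
    destruct (HL (x + i) (y + Z.of_nat n - 1)) as [_ H1].
    destruct (HL (x + i) (y - 1)) as [_ H2].
    rewrite Z.sub_add in H1, H2. lia.
Qed.

(* Every block carrying mass would make the total mass quadratic in [k],
   whereas the flux is linear in [k]. *)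
Lemma exists_harmonic_block (G : Z * Z -> Z) (L : Z) (k r : nat) (x y : Z) :
  superharmonic G -> lipschitz L G -> 4 * L * Z.of_nat r < Z.of_nat k ->
  exists a b, 0 <= a < Z.of_nat k /\ 0 <= b < Z.of_nat k /\
    forall i j, 0 <= i < Z.of_nat r -> 0 <= j < Z.of_nat r ->
      laplacian G (x + (a * Z.of_nat r + i), y + (b * Z.of_nat r + j)) = 0.
Proof.
  intros HG HL Hk. apply NNPP. intros Hno.
  pose proof (laplacian_sum_ge G L (k * r) x y HL) as Hge.
  rewrite sumZ_blocks in Hge.
  rewrite (sumZ_ext k _ (fun a => sumZ k (fun b => sumZ r (fun i => sumZ r (fun j =>
    laplacian G (x + (a * Z.of_nat r + i), y + (b * Z.of_nat r + j))))))) in Hge.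
  2:{ intros a _. etransitivity; [|apply sumZ_swap]. apply sumZ_ext. intros i _.
      apply sumZ_blocks. }
  (* The Laplacian is a nonpositive integer, so one nonzero value already brings a block sum down to
     [-1]. *)
  assert (forall a b, 0 <= a < Z.of_nat k -> 0 <= b < Z.of_nat k ->
    sumZ r (fun i => sumZ r (fun j =>
      laplacian G (x + (a * Z.of_nat r + i), y + (b * Z.of_nat r + j)))) <= -1)
    as Hblock.
  { intros a b Ha Hb. apply NNPP. intros Hgt. apply Hno. exists a, b.
    split; [exact Ha|]. split; [exact Hb|]. intros i j Hi Hj. apply NNPP. intros Hne.
    apply Hgt.
    assert (forall i', sumZ r (fun j =>
      laplacian G (x + (a * Z.of_nat r + i'), y + (b * Z.of_nat r + j))) <= 0) as Hrow.
    { intros i'. rewrite <- (Z.mul_0_r (Z.of_nat r)), <- (sumZ_const r 0).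
      apply sumZ_le. intros; apply HG. }
    pose proof (sumZ_le_term r _ i (fun i' _ => Hrow i') Hi) as H1.
    pose proof (sumZ_le_term r (fun j =>
      laplacian G (x + (a * Z.of_nat r + i), y + (b * Z.of_nat r + j))) j
      (fun _ _ => HG _) Hj) as H2.
    eapply Z.le_trans; [exact H1|]. eapply Z.le_trans; [exact H2|].
    pose proof (HG (x + (a * Z.of_nat r + i), y + (b * Z.of_nat r + j))). lia. }
  assert (sumZ k (fun a => sumZ k (fun b => sumZ r (fun i => sumZ r (fun j =>
    laplacian G (x + (a * Z.of_nat r + i), y + (b * Z.of_nat r + j)))))) <=
    sumZ k (fun _ => sumZ k (fun _ => -1))) as Hle.
  { apply sumZ_le. intros a Ha. apply sumZ_le. intros b Hb. now apply Hblock. }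
  rewrite !sumZ_const in Hle. rewrite Nat2Z.inj_mul in Hge.
  assert (0 <= L) by (destruct (HL 0 0); lia).
  (* The [k * k] blocks give a total of at most [-k * k], below the flux bound [-4 L k r]. *)
  assert (0 < Z.of_nat k * (Z.of_nat k - 4 * L * Z.of_nat r)) by (apply Z.mul_pos_pos; nia).
  lia.
Qed.

(** * Minimum principle and harmonic balls *)

Definition l1dist (v w : Z * Z) : Z :=
  Z.abs (fst v - fst w) + Z.abs (snd v - snd w).

Lemma l1dist_triangle (u v w : Z * Z) : l1dist u w <= l1dist u v + l1dist v w.
Proof. unfold l1dist; lia. Qed.

(** Zeros spread outwards: at a zero inside the ball, the nonnegative neighbours have nonpositive
    sum, so all of them vanish. *)
Lemma strong_minimum_principle (W : Z * Z -> Z) (z : Z * Z) (r : Z) :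
  (forall v, l1dist v z <= r -> 0 <= W v) ->
  (forall v, l1dist v z < r -> laplacian W v <= 0) ->
  W z = 0 -> forall v, l1dist v z <= r -> W v = 0.
Proof.
  intros Hpos Hlap Hz.
  assert (forall (k : nat) v, l1dist v z = Z.of_nat k -> l1dist v z <= r -> W v = 0) as H.
  { induction k as [|k IH]; destruct z as [a b]; intros [x y] Hk Hr;
      unfold l1dist in *; simpl fst in *; simpl snd in *.
    - replace x with a by lia. replace y with b by lia. exact Hz.
    - assert (forall x' y', Z.abs (x' - a) + Z.abs (y' - b) = Z.of_nat k ->
        W (x' + 1, y') = 0 /\ W (x' - 1, y') = 0 /\
        W (x', y' + 1) = 0 /\ W (x', y' - 1) = 0) as Hn.
      { intros x' y' Hd.
        pose proof (IH (x', y') ltac:(simpl; lia) ltac:(simpl; lia)) as H0.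
        pose proof (Hlap (x', y') ltac:(simpl; lia)) as H1.
        unfold laplacian in H1.
        pose proof (Hpos (x' + 1, y') ltac:(simpl; lia)).
        pose proof (Hpos (x' - 1, y') ltac:(simpl; lia)).
        pose proof (Hpos (x', y' + 1) ltac:(simpl; lia)).
        pose proof (Hpos (x', y' - 1) ltac:(simpl; lia)). lia. }
      destruct (Ztrichotomy x a) as [Hx | [Hx | Hx]].
      + destruct (Hn (x + 1) y) as (_ & H & _); [lia|]. now rewrite Z.add_simpl_r in H.
      + destruct (Z_lt_le_dec y b).
        * destruct (Hn x (y + 1)) as (_ & _ & _ & H); [lia|]. now rewrite Z.add_simpl_r in H.
        * destruct (Hn x (y - 1)) as (_ & _ & H & _); [lia|]. now rewrite Z.sub_add in H.
      + destruct (Hn (x - 1) y) as (H & _); [lia|]. now rewrite Z.sub_add in H. }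
  intros v Hv. apply (H (Z.to_nat (l1dist v z))); [|exact Hv].
  unfold l1dist; lia.
Qed.

Lemma exists_harmonic_ball (L R : Z) : 0 <= R ->
  exists K, forall G x y, superharmonic G -> lipschitz L G ->
    exists x' y', Z.abs (x' - x) <= K /\ Z.abs (y' - y) <= K /\
      forall v, l1dist v (x', y') <= R -> laplacian G v = 0.
Proof.
  (* A block of side [2R + 1] contains the ball of radius [R] about its centre, and [k] exceeds
     [4 L r]. *)
  intros HR. set (r := Z.to_nat (2 * R + 1)).
  set (k := Z.to_nat (4 * L * Z.of_nat r + 1)).
  assert (Z.of_nat r = 2 * R + 1) as Hr by (unfold r; lia).
  exists (Z.of_nat k * Z.of_nat r). intros G x y Hsup HL.
  destruct (exists_harmonic_block G L k r x y Hsup HL)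
    as (i & j & Hi & Hj & Hharm); [unfold k; lia|].
  exists (x + (i * Z.of_nat r + R)), (y + (j * Z.of_nat r + R)).
  clearbody k r.
  assert (forall a, 0 <= a < Z.of_nat k -> 0 <= a * Z.of_nat r + R <= Z.of_nat k * Z.of_nat r)
    as Hbound by (intros; nia).
  pose proof (Hbound i Hi). pose proof (Hbound j Hj).
  split; [lia|]. split; [lia|]. intros [x' y'] Hd.
  unfold l1dist in Hd; cbn [fst snd] in Hd.
  rewrite <- (Hharm (x' - x - i * Z.of_nat r) (y' - y - j * Z.of_nat r)) by lia.
  f_equal. f_equal; lia.
Qed.

(** * Linear forms and increments of harmonic functions *)

Definition form (p q : Z) (v : Z * Z) : Z := p * fst v + q * snd v.

Lemma form_shift (p q x y k a b : Z) :
  form p q (x + k * a, y + k * b) = form p q (x, y) + k * form p q (a, b).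
Proof. unfold form; simpl; ring. Qed.

Lemma form_lipschitz (p q K : Z) (v w : Z * Z) :
  Z.abs (fst w - fst v) <= K -> Z.abs (snd w - snd v) <= K ->
  Z.abs (form p q w - form p q v) <= (Z.abs p + Z.abs q) * K.
Proof.
  intros H1 H2. unfold form.
  replace (p * fst w + q * snd w - (p * fst v + q * snd v))
    with (p * (fst w - fst v) + q * (snd w - snd v)) by ring.
  eapply Z.le_trans; [apply Z.abs_triangle|]. rewrite !Z.abs_mul.
  pose proof (Z.mul_le_mono_nonneg_l _ _ (Z.abs p) (Z.abs_nonneg p) H1).
  pose proof (Z.mul_le_mono_nonneg_l _ _ (Z.abs q) (Z.abs_nonneg q) H2). lia.
Qed.

(* A harmonic function whose increments in the direction [e] only take the
   values 0 and 1 has constant increments, by the minimum principle. *)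
Lemma harmonic_increment_constant (G : Z * Z -> Z) (e1 e2 x0 y0 R : Z) :
  0 <= R ->
  (forall x y, 0 <= G (x + e1, y + e2) - G (x, y) <= 1) ->
  (forall v, l1dist v (x0, y0) <= R + (Z.abs e1 + Z.abs e2) -> laplacian G v = 0) ->
  exists a, (a = 0 \/ a = 1) /\
    forall x y, l1dist (x, y) (x0, y0) <= R -> G (x + e1, y + e2) - G (x, y) = a.
Proof.
  intros HR Hinc Hharm.
  set (h := fun v : Z * Z => G (fst v + e1, snd v + e2) - G v).
  assert (forall v, l1dist v (x0, y0) < R -> laplacian h v = 0) as Hh.
  { intros [x y] Hd.
    pose proof (Hharm (x, y)) as Ha. pose proof (Hharm (x + e1, y + e2)) as Hb.
    unfold l1dist in *; cbn [fst snd] in *.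
    specialize (Ha ltac:(lia)). specialize (Hb ltac:(lia)).
    unfold h, laplacian in *; cbn [fst snd] in *.
    replace (x + 1 + e1) with (x + e1 + 1) by lia.
    replace (x - 1 + e1) with (x + e1 - 1) by lia.
    replace (y + 1 + e2) with (y + e2 + 1) by lia.
    replace (y - 1 + e2) with (y + e2 - 1) by lia. lia. }
  assert (forall v, 0 <= h v <= 1) as Hb by (intros [x y]; apply Hinc).
  (* Both possible values are extremal, so the centre minimizes [h] or [1 - h]. *)
  assert (h (x0, y0) = 0 \/ h (x0, y0) = 1) as [H0 | H0]
    by (pose proof (Hb (x0, y0)); lia).
  - exists 0. split; [auto|]. intros x y Hd. change (h (x, y) = 0).
    apply (strong_minimum_principle h (x0, y0) R); auto.
    + intros; apply Hb.
    + intros v Hv. rewrite Hh; [lia | exact Hv].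
  - exists 1. split; [auto|]. intros x y Hd.
    assert (1 - h (x, y) = 0) as H1.
    { apply (strong_minimum_principle (fun v => 1 - h v) (x0, y0) R); [| | lia | exact Hd].
      - intros v _. pose proof (Hb v). lia.
      - intros [x' y'] Hv. pose proof (Hh _ Hv) as H. unfold laplacian in *. lia. }
    unfold h in H1; cbn [fst snd] in H1. lia.
Qed.

(** The factor [1 - 2 * a] orients the walk: along the vector if [a = 0], against it if [a = 1], so
    that each step lowers [G] by [a]. *)
Lemma walk_along_increment (G : Z * Z -> Z) (a e1 e2 x0 y0 : Z) (n : nat) :
  a = 0 \/ a = 1 ->
  (forall x y, l1dist (x, y) (x0, y0) <= Z.of_nat n * (Z.abs e1 + Z.abs e2) ->
     G (x + e1, y + e2) - G (x, y) = a) ->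
  forall i : nat, (i <= n)%nat ->
    G (x0 + Z.of_nat i * ((1 - 2 * a) * e1), y0 + Z.of_nat i * ((1 - 2 * a) * e2)) =
    G (x0, y0) - Z.of_nat i * a.
Proof.
  intros Ha Hinc i. induction i as [|i IH]; intros Hi.
  - rewrite !Z.mul_0_l, !Z.add_0_r, Z.sub_0_r. reflexivity.
  - specialize (IH ltac:(lia)).
    assert (forall j : Z, 0 <= j <= Z.of_nat n -> forall s, s = 1 \/ s = -1 ->
      l1dist (x0 + j * (s * e1), y0 + j * (s * e2)) (x0, y0)
        <= Z.of_nat n * (Z.abs e1 + Z.abs e2)) as Hd.
    { intros j Hj s Hs. unfold l1dist; cbn [fst snd].
      replace (x0 + j * (s * e1) - x0) with (j * (s * e1)) by ring.
      replace (y0 + j * (s * e2) - y0) with (j * (s * e2)) by ring.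
      rewrite !Z.abs_mul. destruct Hs as [-> | ->];
        change (Z.abs 1) with 1; change (Z.abs (-1)) with 1; nia. }
    destruct Ha as [-> | ->].
    + pose proof (Hinc _ _ (Hd (Z.of_nat i) ltac:(lia) 1 ltac:(lia))) as H.
      change (1 - 2 * 0) with 1 in *. rewrite !Z.mul_1_l in *.
      replace (x0 + Z.of_nat (S i) * e1) with (x0 + Z.of_nat i * e1 + e1) by lia.
      replace (y0 + Z.of_nat (S i) * e2) with (y0 + Z.of_nat i * e2 + e2) by lia. lia.
    + pose proof (Hinc _ _ (Hd (Z.of_nat (S i)) ltac:(lia) (-1) ltac:(lia))) as H.
      change (1 - 2 * 1) with (-1) in *.
      replace (x0 + Z.of_nat (S i) * (-1 * e1) + e1)
        with (x0 + Z.of_nat i * (-1 * e1)) in H by lia.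
      replace (y0 + Z.of_nat (S i) * (-1 * e2) + e2)
        with (y0 + Z.of_nat i * (-1 * e2)) in H by lia. lia.
Qed.

(** * Unimodular coordinates and unit slopes *)

Section UnimodularCoordinates.

Variables p1 q1 p2 q2 : Z.
Hypothesis hdet : p1 * q2 - p2 * q1 = 1.

Local Notation l1 := (form p1 q1).
Local Notation l2 := (form p2 q2).
Local Notation L := (Z.abs p1 + Z.abs q1 + Z.abs p2 + Z.abs q2).

(* In the coordinates [(l1, l2)] both coordinate increments of [G] are 0 or 1. *)
Definition unit_slopes (G : Z * Z -> Z) : Prop :=
  forall v w, Z.min 0 (l1 w - l1 v) + Z.min 0 (l2 w - l2 v) <= G w - G v.

Lemma unit_slopes_lipschitz (G : Z * Z -> Z) : unit_slopes G -> lipschitz L G.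
Proof.
  intros HG x y.
  pose proof (HG (x, y) (x + 1, y)) as H1. pose proof (HG (x + 1, y) (x, y)) as H2.
  pose proof (HG (x, y) (x, y + 1)) as H3. pose proof (HG (x, y + 1) (x, y)) as H4.
  unfold form in *; cbn [fst snd] in *. rewrite !Z.mul_add_distr_l in *. lia.
Qed.

Lemma unit_slopes_near (G : Z * Z -> Z) (K : Z) (v w : Z * Z) :
  unit_slopes G ->
  Z.abs (fst w - fst v) <= K -> Z.abs (snd w - snd v) <= K ->
  Z.abs (G w - G v) <= L * K.
Proof.
  intros HG H1 H2. pose proof (HG v w) as Hvw. pose proof (HG w v) as Hwv.
  pose proof (form_lipschitz p1 q1 K v w H1 H2) as Hl1.
  pose proof (form_lipschitz p2 q2 K v w H1 H2) as Hl2.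
  replace (L * K) with ((Z.abs p1 + Z.abs q1) * K + (Z.abs p2 + Z.abs q2) * K) by ring.
  clear - Hvw Hwv Hl1 Hl2. generalize dependent ((Z.abs p1 + Z.abs q1) * K).
  generalize dependent ((Z.abs p2 + Z.abs q2) * K). intros; lia.
Qed.

(* [S] is the infimal convolution of [G] with the support function of the unit
   square: the largest function below [G] with unit slopes. *)
Lemma unit_slopes_regularization (F G : Z * Z -> Z) (n : Z) :
  unit_slopes F -> superharmonic G -> (forall v, F v - n <= G v) ->
  exists S, superharmonic S /\ unit_slopes S /\
    (forall v, F v - n <= S v) /\ (forall v, S v <= G v) /\
    forall v, exists z,
      S v = G z - Z.min 0 (l1 z - l1 v) - Z.min 0 (l2 z - l2 v).
Proof.
  intros HF HG Hn.
  set (A := fun v k => exists z,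
    k = G z - Z.min 0 (l1 z - l1 v) - Z.min 0 (l2 z - l2 v)).
  assert (forall v, is_minimum (A v) (epsilon (inhabits 0) (is_minimum (A v)))) as Hmin.
  { intros v. apply epsilon_spec. apply (bounded_below_minimum _ (F v - n) (G v)).
    - intros k [z ->]. pose proof (HF v z). pose proof (Hn z). lia.
    - exists v. lia. }
  set (S := fun v => epsilon (inhabits 0) (is_minimum (A v))) in *.
  assert (forall v z, S v <= G z - Z.min 0 (l1 z - l1 v) - Z.min 0 (l2 z - l2 v)) as Hle.
  { intros v z. apply (Hmin v). now exists z. }
  assert (forall v, exists z,
    S v = G z - Z.min 0 (l1 z - l1 v) - Z.min 0 (l2 z - l2 v)) as Hat
    by (intros v; apply (Hmin v)).
  exists S. split; [|split; [|split; [|split]]]; auto.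
  (* Translating the minimizer [(a, b)] together with the point bounds [S] at the four neighbours,
     so the Laplacian of [S] at [(x, y)] is at most that of [G] at [(a, b)]. *)
  - intros [x y]. destruct (Hat (x, y)) as [[a b] E].
    pose proof (HG (a, b)) as H. unfold laplacian in *.
    pose proof (Hle (x + 1, y) (a + 1, b)) as H1.
    pose proof (Hle (x - 1, y) (a - 1, b)) as H2.
    pose proof (Hle (x, y + 1) (a, b + 1)) as H3.
    pose proof (Hle (x, y - 1) (a, b - 1)) as H4.
    unfold form in *; cbn [fst snd] in *.
    rewrite ?Z.mul_add_distr_l, ?Z.mul_sub_distr_l in *. lia.
  (* [Z.min 0] is superadditive. *)
  - intros v w. destruct (Hat w) as [z E]. pose proof (Hle v z). lia.
  - intros v. destruct (Hat v) as [z E]. pose proof (HF v z). pose proof (Hn z). lia.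
  - intros v. pose proof (Hle v v). lia.
Qed.

(** * Minima of affine functions and agreement away from the corner locus *)

(* [A] is a set of vertices of the unit square and [c] gives the constant terms
   of the affine functions whose minimum is [F]. *)
Definition tropical (A : Z -> Z -> Prop) (c : Z -> Z -> Z) (F : Z * Z -> Z) : Prop :=
  (forall a b, A a b -> (a = 0 \/ a = 1) /\ (b = 0 \/ b = 1)) /\
  (forall a b v, A a b -> F v <= a * l1 v + b * l2 v + c a b) /\
  (forall v, exists a b, A a b /\ F v = a * l1 v + b * l2 v + c a b).

Lemma tropical_unit_slopes A c F : tropical A c F -> unit_slopes F.
Proof.
  intros (H01 & Hle & Hat) v w. destruct (Hat w) as (a & b & HA & E).
  pose proof (Hle a b v HA). destruct (H01 a b HA) as [[-> | ->] [-> | ->]]; lia.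
Qed.

(** With [M = 0] this is the domain where [F] is affine of slope [(a, b)]; a larger [M] keeps away
    from its boundary. *)
Definition gap (A : Z -> Z -> Prop) (c : Z -> Z -> Z) (M a b : Z) (v : Z * Z) : Prop :=
  forall a' b', A a' b' -> a' <> a \/ b' <> b ->
    a * l1 v + b * l2 v + c a b + M <= a' * l1 v + b' * l2 v + c a' b'.

(* A weakening of the neighbourhood condition of [Theta] that survives the
   infimal convolution. *)
Definition agree_far A c (M : Z) (F G : Z * Z -> Z) : Prop :=
  forall a b v, A a b -> gap A c M a b v -> G v = F v.

Lemma tropical_gap_value A c F a b v :
  tropical A c F -> A a b -> gap A c 0 a b v -> F v = a * l1 v + b * l2 v + c a b.
Proof.
  intros (H01 & Hle & Hat) HA Hg. destruct (Hat v) as (a' & b' & HA' & E).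
  pose proof (Hle a b v HA).
  destruct (classic (a' = a /\ b' = b)) as [[-> ->] | Hne]; [exact E|].
  pose proof (Hg a' b' HA' ltac:(lia)). lia.
Qed.

Lemma tropical_not_gap A c F M a b v :
  tropical A c F -> 0 <= M -> ~ gap A c M a b v ->
  exists a' b', A a' b' /\ (a' <> a \/ b' <> b) /\
    a' * l1 v + b' * l2 v + c a' b' <= F v + M.
Proof.
  intros (_ & _ & Hat) HM Hng.
  destruct (Hat v) as (a0 & b0 & HA0 & E).
  destruct (classic (a0 = a /\ b0 = b)) as [[-> ->] | Hne].
  - apply NNPP. intros Hno. apply Hng. intros a' b' HA' Hne.
    apply Z.nlt_ge. intros Hlt. apply Hno. exists a', b'. repeat split; auto. lia.
  - exists a0, b0. repeat split; [auto | lia | lia].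
Qed.

(** Let [z] attain [S v]. If [G z = F z], the unit slopes of [F] give [F v <= S v]. Otherwise
    another affine function is at most [F z + M], hence at most [G z + M + n]; carried back to [v],
    its value is at most [S v + M + n], and the gap at [v] concludes. *)
Lemma agree_far_regularization A c F G S (M n : Z) :
  tropical A c F -> agree_far A c M F G -> 0 <= M -> 0 <= n ->
  (forall v, F v - n <= G v <= F v) -> (forall v, S v <= G v) ->
  (forall v, exists z,
      S v = G z - Z.min 0 (l1 z - l1 v) - Z.min 0 (l2 z - l2 v)) ->
  agree_far A c (M + n) F S.
Proof.
  intros HF Hfar HM Hn HG Hle Hat a b v HA Hgap.
  pose proof (Hle v). pose proof (HG v).
  destruct (Hat v) as [z E].
  enough (F v <= S v) by lia.
  destruct (Z.eq_dec (G z) (F z)) as [Ez | Nz].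
  - pose proof (tropical_unit_slopes _ _ _ HF v z). lia.
  - destruct (tropical_not_gap _ _ _ _ a b z HF HM (fun Hg => Nz (Hfar a b z HA Hg)))
      as (a' & b' & HA' & Hne & Hz).
    pose proof (Hgap a' b' HA' Hne). pose proof (HG z).
    destruct HF as (H01 & HFle & _). pose proof (HFle a b v HA).
    destruct (H01 a' b' HA') as [[-> | ->] [-> | ->]]; lia.
Qed.

(** Two vertices of the square differ by 0, 1 or -1 in each coordinate, so the difference of their
    affine functions varies by at most [L * K]. *)
Lemma gap_near A c (a b K M : Z) (v w : Z * Z) :
  (forall a b, A a b -> (a = 0 \/ a = 1) /\ (b = 0 \/ b = 1)) -> A a b ->
  Z.abs (fst w - fst v) <= K -> Z.abs (snd w - snd v) <= K ->
  gap A c (M + L * K) a b v -> gap A c M a b w.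
Proof.
  intros H01 HA H1 H2 Hg a' b' HA' Hne. pose proof (Hg a' b' HA' Hne).
  pose proof (form_lipschitz p1 q1 K v w H1 H2).
  pose proof (form_lipschitz p2 q2 K v w H1 H2).
  destruct (H01 a' b' HA') as [[-> | ->] [-> | ->]];
  destruct (H01 a b HA) as [[-> | ->] [-> | ->]]; lia.
Qed.

Lemma neighborhood_box (C : R) (D : Z * Z -> Prop) (v : Z * Z) :
  neighborhood C D v ->
  exists w, D w /\ Z.abs (fst w - fst v) <= up (Rabs C) /\ Z.abs (snd w - snd v) <= up (Rabs C).
Proof.
  intros [w [Dw Hd]]. exists w. split; [exact Dw|].
  assert (forall a b : Z, (Rabs (IZR a - IZR b) <= C)%R -> Z.abs (b - a) <= up (Rabs C)) as Hab.
  { intros a b H. apply le_IZR. rewrite abs_IZR, minus_IZR, Rabs_minus_sym.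
    pose proof (archimed (Rabs C)) as [H1 _]. pose proof (Rle_abs C). lra. }
  unfold dist_lattice, dist_euc in Hd.
  split; apply Hab; (eapply Rle_trans; [|exact Hd]);
    rewrite <- sqrt_Rsqr_abs; apply sqrt_le_1_alt;
    match goal with |- (_ <= Rsqr ?a + Rsqr ?b)%R =>
      pose proof (Rle_0_sqr a); pose proof (Rle_0_sqr b) end; lra.
Qed.

Lemma Theta_agree_far A c F G n :
  tropical A c F -> Theta n F G -> exists M, 0 <= M /\ agree_far A c M F G.
Proof.
  intros HF (_ & _ & C & _ & HC).
  (* The margin makes [F] affine up to distance [Z.abs K] from [v], where a deviation point would
     lie, and one unit further for its neighbours. *)
  set (K := up (Rabs C)) in *. exists (L * (Z.abs K + 1)). split; [nia|].
  intros a b v HA Hg. apply NNPP. intros Hne.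
  assert (neighborhood C (deviation_set F) v) as Hnb by (apply HC; congruence).
  apply neighborhood_box in Hnb. fold K in Hnb.
  destruct Hnb as ([x y] & Hdev & H1 & H2). apply Hdev.
  assert (forall w, Z.abs (fst w - x) <= 1 -> Z.abs (snd w - y) <= 1 ->
    F w = a * l1 w + b * l2 w + c a b) as Hlin.
  { intros w Hx Hy. apply (tropical_gap_value _ _ _ _ _ _ HF HA).
    apply (gap_near A c a b (Z.abs K + 1) 0 v w); auto; try (apply HF);
      cbn [fst snd] in *; lia. }
  unfold laplacian. rewrite !Hlin by (cbn [fst snd]; lia).
  unfold form; cbn [fst snd]. ring.
Qed.

(** * Propagation along the diagonals of quadrants *)

Local Notation u1 a b := ((1 - 2 * a) * q2 - (1 - 2 * b) * q1).
Local Notation u2 a b := ((1 - 2 * b) * p1 - (1 - 2 * a) * p2).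

(** By Cramer's rule with determinant 1, the direction [(u1 a b, u2 a b)] solves [l1 = 1 - 2 * a],
    [l2 = 1 - 2 * b]: each coordinate decreases where the slope is 1 and increases where it is 0. *)
Lemma l1_ray a b x y k :
  l1 (x + k * u1 a b, y + k * u2 a b) = l1 (x, y) + k * (1 - 2 * a).
Proof.
  rewrite form_shift. f_equal. f_equal. unfold form; cbn [fst snd].
  transitivity ((1 - 2 * a) * (p1 * q2 - p2 * q1)); [ring | rewrite hdet; ring].
Qed.

Lemma l2_ray a b x y k :
  l2 (x + k * u1 a b, y + k * u2 a b) = l2 (x, y) + k * (1 - 2 * b).
Proof.
  rewrite form_shift. f_equal. f_equal. unfold form; cbn [fst snd].
  transitivity ((1 - 2 * b) * (p1 * q2 - p2 * q1)); [ring | rewrite hdet; ring].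
Qed.

(* [G] minus the affine function of slope [(a, b)] is superharmonic, nonnegative
   on a quadrant with apex [(x, y)], and vanishes at an interior point, hence by
   the minimum principle on the whole diagonal of the quadrant. *)
Lemma affine_on_ray (G : Z * Z -> Z) (a b x y : Z) (k : nat) :
  superharmonic G -> unit_slopes G -> a = 0 \/ a = 1 -> b = 0 \/ b = 1 ->
  G (x + L * L * u1 a b, y + L * L * u2 a b) = G (x, y) - L * L * (a + b) ->
  let k' := L * L + Z.of_nat k in
  G (x + k' * u1 a b, y + k' * u2 a b) = G (x, y) - k' * (a + b).
Proof.
  intros Hsup HG Ha Hb H0. induction k as [|k IH]; intros k'; subst k'.
  { change (Z.of_nat 0) with 0. rewrite Z.add_0_r. exact H0. }
  cbv zeta in IH. set (k0 := L * L + Z.of_nat k) in *.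
  replace (L * L + Z.of_nat (S k)) with (k0 + 1) by lia.
  set (W := fun v => G v - G (x, y) - a * (l1 v - l1 (x, y)) - b * (l2 v - l2 (x, y))).
  set (z := (x + k0 * u1 a b, y + k0 * u2 a b)) in *.
  assert (W (x + (k0 + 1) * u1 a b, y + (k0 + 1) * u2 a b) = 0) as HW.
  (* One step of the ray has length at most [L]. Over this radius the forms change by at most
     [L * L], while [z] is at least that deep in the quadrant; so the ball stays inside, where unit
     slopes seen from the apex give [0 <= W]. *)
  { apply (strong_minimum_principle W z L).
    - intros v Hv. unfold l1dist in Hv.
      pose proof (form_lipschitz p1 q1 L z v ltac:(lia) ltac:(lia)) as H1.
      pose proof (form_lipschitz p2 q2 L z v ltac:(lia) ltac:(lia)) as H2.
      unfold z in H1, H2. rewrite l1_ray in H1. rewrite l2_ray in H2.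
      assert ((Z.abs p1 + Z.abs q1) * L <= L * L) by (apply Z.mul_le_mono_nonneg_r; lia).
      assert ((Z.abs p2 + Z.abs q2) * L <= L * L) by (apply Z.mul_le_mono_nonneg_r; lia).
      pose proof (HG (x, y) v). unfold W.
      destruct Ha as [-> | ->], Hb as [-> | ->]; lia.
    - intros [x' y'] _. pose proof (Hsup (x', y')) as H.
      unfold W, laplacian, form in *; cbn [fst snd] in *.
      rewrite ?Z.mul_add_distr_l, ?Z.mul_sub_distr_l in *. lia.
    - unfold W, z. rewrite l1_ray, l2_ray. fold z. rewrite IH.
      destruct Ha as [-> | ->], Hb as [-> | ->]; lia.
    - unfold l1dist, z; cbn [fst snd].
      replace (x + (k0 + 1) * u1 a b - (x + k0 * u1 a b)) with (u1 a b) by ring.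
      replace (y + (k0 + 1) * u2 a b - (y + k0 * u2 a b)) with (u2 a b) by ring.
      destruct Ha as [-> | ->], Hb as [-> | ->]; lia. }
  unfold W in HW. rewrite l1_ray, l2_ray in HW.
  destruct Ha as [-> | ->], Hb as [-> | ->]; lia.
Qed.

(** Each step moves every other vertex's function up by at least 1 relative to that of [(a, b)];
    [k0] absorbs the constants. *)
Lemma gap_on_ray A c (a b x y M : Z) :
  (forall a b, A a b -> (a = 0 \/ a = 1) /\ (b = 0 \/ b = 1)) -> A a b ->
  exists k0, forall k, k0 <= k -> gap A c M a b (x + k * u1 a b, y + k * u2 a b).
Proof.
  intros H01 HA.
  exists (Z.abs M + Z.abs (l1 (x, y)) + Z.abs (l2 (x, y)) + Z.abs (c a b)
          + Z.abs (c 0 0) + Z.abs (c 0 1) + Z.abs (c 1 0) + Z.abs (c 1 1)).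
  intros k Hk a' b' HA' Hne. rewrite l1_ray, l2_ray.
  destruct (H01 a b HA) as [[-> | ->] [-> | ->]];
  destruct (H01 a' b' HA') as [[-> | ->] [-> | ->]]; lia.
Qed.

(** If the slope occurs in [F], then [S = F] far along the ray. Coming back to the apex, [S] rises
    by exactly [k' * (a + b)] and [F] by at most that. *)
Lemma affine_ray_value A c F S (M n a b x y : Z) :
  tropical A c F -> agree_far A c M F S -> (forall v, F v - n <= S v) ->
  a = 0 \/ a = 1 -> b = 0 \/ b = 1 ->
  (forall k : nat, let k' := L * L + Z.of_nat k in
    S (x + k' * u1 a b, y + k' * u2 a b) = S (x, y) - k' * (a + b)) ->
  F (x, y) <= S (x, y).
Proof.
  intros HF Hfar Hn Ha Hb Hray. assert (0 <= L * L) by apply Z.square_nonneg.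
  destruct (classic (A a b)) as [HA | HnA].
  - destruct (gap_on_ray A c a b x y M (proj1 HF) HA) as [k0 Hk0].
    specialize (Hray (Z.to_nat k0)). cbv zeta in Hray.
    set (k := L * L + Z.of_nat (Z.to_nat k0)) in *.
    rewrite (Hfar a b _ HA (Hk0 k ltac:(lia))) in Hray.
    pose proof (tropical_unit_slopes _ _ _ HF (x, y) (x + k * u1 a b, y + k * u2 a b)) as H1.
    rewrite l1_ray, l2_ray in H1.
    destruct Ha as [-> | ->], Hb as [-> | ->]; lia.
  - (* The slope [(a, b)] does not occur in [F], so [F - n] would eventually
       exceed [S] along the ray. *)
    specialize (Hray (Z.to_nat n)). cbv zeta in Hray.
    set (k := L * L + Z.of_nat (Z.to_nat n)) in *.
    pose proof (Hn (x + k * u1 a b, y + k * u2 a b)) as H1.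
    destruct HF as (H01 & Hle & Hat).
    destruct (Hat (x + k * u1 a b, y + k * u2 a b)) as (a' & b' & HA' & E).
    rewrite l1_ray, l2_ray in E. pose proof (Hle a' b' (x, y) HA').
    destruct (H01 a' b' HA') as [[-> | ->] [-> | ->]];
      destruct Ha as [-> | ->], Hb as [-> | ->]; first [contradiction | lia].
Qed.

(** The vectors [(q2, - p2)] and [(- q1, p1)] form the basis dual to [l1], [l2], so increments along
    them are 0 or 1. The radius allows [L * L] steps along both, of total length [L * L * L], and
    [L] more for the shift in the increments. *)
Lemma harmonic_ball_affine (G : Z * Z -> Z) (x y : Z) :
  unit_slopes G ->
  (forall v, l1dist v (x, y) <= L * L * L + L -> laplacian G v = 0) ->
  exists a b, (a = 0 \/ a = 1) /\ (b = 0 \/ b = 1) /\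
    G (x + L * L * u1 a b, y + L * L * u2 a b) = G (x, y) - L * L * (a + b).
Proof.
  intros HG Hharm. assert (0 <= L * L) by apply Z.square_nonneg.
  destruct (harmonic_increment_constant G q2 (- p2) x y (L * L * L)) as (a & Ha & Hinca).
  { apply Z.mul_nonneg_nonneg; lia. }
  { intros x' y'. pose proof (HG (x', y') (x' + q2, y' + - p2)) as H1.
    pose proof (HG (x' + q2, y' + - p2) (x', y')) as H2.
    unfold form in *; cbn [fst snd] in *. lia. }
  { intros v Hv. apply Hharm. lia. }
  destruct (harmonic_increment_constant G (- q1) p1 x y (L * L * L)) as (b & Hb & Hincb).
  { apply Z.mul_nonneg_nonneg; lia. }
  { intros x' y'. pose proof (HG (x', y') (x' + - q1, y' + p1)) as H1.
    pose proof (HG (x' + - q1, y' + p1) (x', y')) as H2.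
    unfold form in *; cbn [fst snd] in *. lia. }
  { intros v Hv. apply Hharm. lia. }
  exists a, b. split; [exact Ha|]. split; [exact Hb|].
  assert (L * L * (Z.abs q2 + Z.abs (- p2)) + L * L * (Z.abs (- q1) + Z.abs p1) = L * L * L)
    as Hsplit by (rewrite !Z.abs_opp; ring).
  assert (L * L * (Z.abs q2 + Z.abs (- p2)) <= L * L * L) as Hpart
    by (apply Z.mul_le_mono_nonneg_l; [apply Z.square_nonneg | lia]).
  set (D := Z.to_nat (L * L)).
  assert (Z.of_nat D = L * L) as HD by (apply Z2Nat.id, Z.square_nonneg).
  pose proof (walk_along_increment G a q2 (- p2) x y D Ha) as W1.
  rewrite HD in W1. specialize (W1 (fun x' y' H' => Hinca x' y' (Z.le_trans _ _ _ H' Hpart)) D (le_n D)).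
  set (x' := x + Z.of_nat D * ((1 - 2 * a) * q2)) in *.
  set (y' := y + Z.of_nat D * ((1 - 2 * a) * - p2)) in *.
  pose proof (walk_along_increment G b (- q1) p1 x' y' D Hb) as W2.
  rewrite HD in W2.
  assert (l1dist (x', y') (x, y) <= L * L * (Z.abs q2 + Z.abs (- p2))) as Hd.
  { unfold l1dist, x', y'; cbn [fst snd]. rewrite HD.
    replace (x + L * L * ((1 - 2 * a) * q2) - x) with (L * L * ((1 - 2 * a) * q2)) by ring.
    replace (y + L * L * ((1 - 2 * a) * - p2) - y) with (L * L * ((1 - 2 * a) * - p2)) by ring.
    rewrite !(Z.abs_mul (L * L)), (Z.abs_eq (L * L)), <- Z.mul_add_distr_l by lia.
    apply Z.mul_le_mono_nonneg_l; [lia|]. clear - Ha. destruct Ha as [-> | ->]; lia. }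
  assert (G (x' + L * L * ((1 - 2 * b) * - q1), y' + L * L * ((1 - 2 * b) * p1)) =
          G (x', y') - L * L * b) as W3.
  { rewrite <- HD. apply W2; [|apply le_n]. intros x'' y'' H''. apply Hincb.
    eapply Z.le_trans; [apply (l1dist_triangle _ (x', y'))|].
    rewrite <- Hsplit, Z.add_comm. apply Z.add_le_mono; assumption. }
  unfold x', y' in W3. rewrite HD in W3.
  replace (x + L * L * u1 a b) with
    (x + L * L * ((1 - 2 * a) * q2) + L * L * ((1 - 2 * b) * - q1)) by ring.
  replace (y + L * L * u2 a b) with
    (y + L * L * ((1 - 2 * a) * - p2) + L * L * ((1 - 2 * b) * p1)) by ring.
  unfold x', y' in W1. rewrite HD in W1. rewrite W3, W1. ring.
Qed.

(** * Uniform bound and stabilization *)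

Lemma Theta_uniform_bound A c F :
  tropical A c F -> exists N : nat, forall n G v, Theta n F G -> F v - Z.of_nat N <= G v.
Proof.
  intros HF. pose proof (tropical_unit_slopes _ _ _ HF) as HF1.
  assert (0 <= L * L * L + L) as HR
    by (apply Z.add_nonneg_nonneg; [apply Z.mul_nonneg_nonneg; [apply Z.square_nonneg|]|]; lia).
  destruct (exists_harmonic_ball L _ HR) as [K HK].
  (* [F] and [S] each change by at most [L * K] between the point and the centre of a harmonic ball,
     where [F <= S]; [K] depends on neither [n] nor [G]. *)
  exists (Z.to_nat (2 * (L * K))). intros n G [x y] HT.
  destruct (Theta_agree_far _ _ _ _ _ HF HT) as (M & HM & Hfar).
  destruct HT as (HG & HGF & _).
  destruct (unit_slopes_regularization F G (Z.of_nat n) HF1 HG (fun v => proj1 (HGF v)))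
    as (S & Ssup & S1 & SF & SG & Sat).
  pose proof (agree_far_regularization A c F G S M (Z.of_nat n) HF Hfar HM
    (Nat2Z.is_nonneg n) HGF SG Sat) as Sfar.
  destruct (HK S x y Ssup (unit_slopes_lipschitz S S1)) as (x' & y' & Hx & Hy & Hharm).
  destruct (harmonic_ball_affine S x' y' S1 Hharm) as (a & b & Ha & Hb & Hab).
  pose proof (affine_ray_value A c F S _ _ a b x' y' HF Sfar SF Ha Hb
    (fun k => affine_on_ray S a b x' y' k Ssup S1 Ha Hb Hab)) as Hval.
  pose proof (unit_slopes_near F K (x, y) (x', y') HF1 Hx Hy) as H1.
  pose proof (unit_slopes_near S K (x, y) (x', y') S1 Hx Hy) as H2.
  pose proof (SG (x, y)) as H3.
  clear - Hval H1 H2 H3. generalize dependent (L * K). intros; lia.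
Qed.

End UnimodularCoordinates.

(** The bound makes [Theta n F] and [Theta N F] the same set for [n > N]. *)
Lemma smoothing_stabilizes (F : Z * Z -> Z) (N : nat) :
  superharmonic F ->
  (forall n G v, Theta n F G -> F v - Z.of_nat N <= G v) ->
  forall n : nat, (N < n)%nat -> smoothing n F = smoothing N F.
Proof.
  intros HF HN n Hn. apply functional_extensionality. intros v.
  destruct (smoothing_spec n F v HF) as [(G & HG & EG) Hmin].
  destruct (smoothing_spec N F v HF) as [(G' & HG' & EG') Hmin'].
  apply Z.le_antisymm.
  - apply Hmin. exists G'. split; [|exact EG'].
    destruct HG' as (H1 & H2 & H3). split; [exact H1|]. split; [|exact H3].
    intros w. pose proof (H2 w). lia.
  - apply Hmin'. exists G. split; [|exact EG].
    pose proof (fun v => HN n G v HG) as H. destruct HG as (H1 & H2 & H3).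
    split; [exact H1|]. split; [|exact H3].
    intros w. pose proof (H2 w). pose proof (H w). lia.
Qed.

Theorem theorem2p5 (p1 p2 q1 q2 c1 c2 : Z) (hdet : p1 * q2 - p2 * q1 = 1)
  (F : Z * Z -> Z)
  (hF : F = Psi_edge p1 q1 \/
        F = Psi_vertex p1 q1 p2 q2 c1 \/
        F = Psi_node p1 q1 p2 q2 c1 c2) :
  exists N : nat, (0 < N)%nat /\
    forall n : nat, (N < n)%nat -> smoothing n F = smoothing N F.
Proof.
  assert (superharmonic F /\ exists A c, tropical p1 q1 p2 q2 A c F) as [Hsup (A & c & HF)].
  { destruct hF as [-> | [-> | ->]]; split.
    - apply superharmonic_Psi_edge.
    - exists (fun a b => (a = 0 \/ a = 1) /\ b = 0), (fun _ _ => 0).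
      split; [|split].
      + tauto.
      + intros a b [x y] [[-> | ->] ->]; unfold Psi_edge, form; cbn [fst snd]; lia.
      + intros [x y]. unfold Psi_edge, form; cbn [fst snd].
        destruct (Z.min_spec 0 (p1 * x + q1 * y)) as [[_ ->] | [_ ->]];
          [exists 0, 0 | exists 1, 0]; lia.
    - apply superharmonic_Psi_vertex.
    - exists (fun a b => (a = 0 \/ a = 1) /\ (b = 0 \/ b = 1) /\ (a = 0 \/ b = 0)),
        (fun _ b => b * c1).
      split; [|split].
      + tauto.
      + intros a b [x y] ([-> | ->] & [-> | ->] & Hab);
          unfold Psi_vertex, form; cbn [fst snd]; lia.
      + intros [x y]. unfold Psi_vertex, form; cbn [fst snd].
        match goal with |- context [Z.min (Z.min ?s ?t) ?w] =>
          assert (Z.min (Z.min s t) w = s \/ Z.min (Z.min s t) w = t \/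
                  Z.min (Z.min s t) w = w) as [-> | [-> | ->]] by lia end;
          [exists 0, 0 | exists 1, 0 | exists 0, 1]; lia.
    - apply superharmonic_Psi_node.
    (* The constant is 0 when [b = 0], [c1] at [(0, 1)] and [c2] at [(1, 1)]. *)
    - exists (fun a b => (a = 0 \/ a = 1) /\ (b = 0 \/ b = 1)),
        (fun a b => b * ((1 - a) * c1 + a * c2)).
      split; [|split].
      + tauto.
      + intros a b [x y] ([-> | ->] & [-> | ->]);
          unfold Psi_node, form; cbn [fst snd]; lia.
      + intros [x y]. unfold Psi_node, form; cbn [fst snd].
        match goal with |- context [Z.min (Z.min (Z.min ?s ?t) ?w) ?o] =>
          assert (Z.min (Z.min (Z.min s t) w) o = s \/ Z.min (Z.min (Z.min s t) w) o = t \/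
                  Z.min (Z.min (Z.min s t) w) o = w \/ Z.min (Z.min (Z.min s t) w) o = o)
            as [-> | [-> | [-> | ->]]] by lia end;
          [exists 0, 0 | exists 1, 0 | exists 0, 1 | exists 1, 1]; lia. }
  destruct (Theta_uniform_bound p1 q1 p2 q2 hdet A c F HF) as [N HN].
  exists (S N). split; [lia|]. apply smoothing_stabilizes; [exact Hsup|].
  intros n G v HG. pose proof (HN n G v HG). lia.
Qed.
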